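(* Let $K=\{x\in\mathbb{Z}^n_+ : a^\top x\le b,\ 0\le x_i\le u_i\ \forall i\in N\}$ be a superincreasing knapsack with greedy solution $\theta$. For any $j\in N$ with $\theta_j<u_j$, the inequality $$x_j+\sum_{i\in I_j}\phi_j(i)(x_i-\theta_i)\le\theta_j$$ is facet-defining for $\operatorname{conv}K$.
   Context: Let $n\ge 1$, $N=\{1,\dots,n\}$, and let $b$, $a_i$, $u_i$ ($i\in N$) be positive integers with $a_iu_i\le b$ for all $i\in N$ and $a^\top u>b$ (standing assumptions). $K$ is a superincreasing knapsack if $\sum_{k=1}^{i}a_ku_k\le a_{i+1}$ for all $1\le i\le n-1$. The greedy solution $\theta\in\mathbb{Z}^n_+$ is defined recursively for $i=n,n-1,\dots,1$ by $\theta_i=\min\{u_i,\lfloor (b-\sum_{k=i+1}^n a_k\theta_k)/a_i\rfloor\}$ (so $\theta_n=u_n$). Let $I=\{i\in N:\theta_i\ge1\}$ (so $n\in I$) and, for $j\in N$, $I_j=\{i\in I: i>j\}$. For $j\in N\setminus\{n\}$ and $i\in I_j$, $$\phi_j(i)=(u_j-\theta_j)\prod_{k\in I,\ j<k<i}(u_k+1-\theta_k),$$ with empty products equal to $1$. The polytope $\operatorname{conv}K\subset\mathbb{R}^n$ is $n$-dimensional; an inequality is facet-defining for it if it is valid for it and the set of points of $\operatorname{conv}K$ satisfying it with equality contains $n$ affinely independent points and is not all of $\operatorname{conv}K$. *)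

(* Defs.v *)
From HB Require Import structures.
From mathcomp Require Import all_boot all_order all_algebra.
From mathcomp Require Import classical_sets reals convex.

Set Implicit Arguments.
Unset Strict Implicit.
Unset Printing Implicit Defensive.

Import Order.TTheory GRing.Theory Num.Theory.

Local Open Scope classical_set_scope.
Local Open Scope ring_scope.

(* The index set N = {1, ..., n} is rendered as 'I_n = {0, ..., n-1}. *)

Definition knapsack (n : nat) (a u : 'I_n -> nat) (b : nat) : set 'rV[int]_n :=
  [set x | \sum_i (a i)%:Z * x 0 i <= b%:Z /\
           forall i, 0 <= x 0 i <= (u i)%:Z].

Definition superincreasing (n : nat) (a u : 'I_n -> nat) : Prop :=
  forall i j : 'I_n, j = i.+1 :> nat ->
    (\sum_(k < n | (k <= i)%N) a k * u k <= a j)%N.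

(* The nat subtraction never truncates (is_greedy_feasible), and the recursion
   has exactly one solution (is_greedy_exists, is_greedy_unique). *)
Definition is_greedy (n : nat) (a u : 'I_n -> nat) (b : nat)
    (theta : 'I_n -> nat) : Prop :=
  forall i : 'I_n, theta i =
    minn (u i) ((b - \sum_(k < n | (i < k)%N) a k * theta k) %/ a i)%N.

Lemma is_greedy_feasible (n : nat) (a u : 'I_n -> nat) (b : nat)
    (theta : 'I_n -> nat) (m : nat) :
  is_greedy a u b theta ->
  (\sum_(k < n | (m <= k)%N) a k * theta k <= b)%N.
Proof.
move=> gr; have [d] := ubnP (n - m)%N; elim: d m => // d IHd m ltd.
have [lenm|ltmn] := leqP n m.
  by rewrite big_pred0 // => k; rewrite leqNgt (leq_trans (ltn_ord k) lenm).
pose i := Ordinal ltmn.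
rewrite (bigD1 i) //= (eq_bigl (fun k : 'I_n => (m < k)%N)); last first.
  by move=> k; rewrite -val_eqE /= ltn_neqAle andbC eq_sym.
have le_b : (\sum_(k < n | (m < k)%N) a k * theta k <= b)%N.
  by apply: IHd; rewrite subnS prednK ?subn_gt0.
rewrite -(subnK le_b) leq_add2r gr /=.
apply: leq_trans (leq_mul (leqnn _) (geq_minr _ _)) _.
by rewrite mulnC leq_divM.
Qed.

Lemma is_greedy_unique (n : nat) (a u : 'I_n -> nat) (b : nat)
    (theta theta' : 'I_n -> nat) :
  is_greedy a u b theta -> is_greedy a u b theta' -> theta =1 theta'.
Proof.
move=> gr gr' i; have [d] := ubnP (n - i)%N.
elim: d i => // d IHd i ltd; rewrite gr gr'; congr (minn _ ((_ - _) %/ _)).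
apply: eq_bigr => k ltik; rewrite IHd //.
by rewrite (leq_trans _ (ltd : (n - i <= d)%N)) // ltn_sub2l.
Qed.

Lemma is_greedy_exists (n : nat) (a u : 'I_n -> nat) (b : nat) :
  exists theta, is_greedy a u b theta.
Proof.
pose F t (i : 'I_n) :=
  minn (u i) ((b - \sum_(k < n | (i < k)%N) a k * t k) %/ a i)%N.
pose t m := iter m F (fun=> 0%N).
have tE m (i : 'I_n) : (n - i <= m)%N -> t m.+1 i = t m i.
  elim: m i => [|m IHm] i le.
    by move: le; rewrite leqn0 subn_eq0 leqNgt ltn_ord.
  rewrite -[LHS]/(F (t m.+1) i) -[RHS]/(F (t m) i) /F.
  congr (minn _ ((_ - _) %/ _)).
  apply: eq_bigr => k ltik; congr (_ * _)%N; apply: IHm.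
  by rewrite -ltnS (leq_trans _ le) // ltn_sub2l.
by exists (t n) => i; rewrite -{1}tE ?leq_subr.
Qed.

(* The set I = {k | theta_k >= 1} enters as the condition 1 <= theta k. *)
Definition phi (n : nat) (u theta : 'I_n -> nat) (j i : 'I_n) : int :=
  ((u j)%:Z - (theta j)%:Z) *
  \prod_(k < n | (1 <= theta k)%N && (j < k < i)%N)
     ((u k)%:Z + 1 - (theta k)%:Z).

Definition conv_hull (R : realType) (n : nat) (A : set 'rV[R]_n) :
    set 'rV[R]_n :=
  smallest (@convex_set R 'rV[R]_n) A.

Definition affinely_independent (R : realType) (n m : nat)
    (p : 'I_m -> 'rV[R]_n) : Prop :=
  forall c : 'I_m -> R,
    \sum_k c k = 0 -> \sum_k c k *: p k = 0 -> forall k, c k = 0.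

(* The inequality is f x <= d; this is the notion of facet appropriate to an
   n-dimensional polytope P. *)
Definition facet_defining (R : realType) (n : nat) (P : set 'rV[R]_n)
    (f : 'rV[R]_n -> R) (d : R) : Prop :=
  let face := [set x | P x /\ f x = d] in
  [/\ forall x, P x -> f x <= d,
      exists2 p : 'I_n -> 'rV[R]_n,
        affinely_independent p & forall k, face (p k)
    & face <> P].

(* Main.v *)
Require Import Defs.
From HB Require Import structures.
From mathcomp Require Import all_boot all_order all_algebra.
From mathcomp Require Import classical_sets reals convex.
From mathcomp Require Import interval_inference ring lra zify.

(** For a superincreasing knapsack, an integer point of the box is feasible
    exactly when it is lexicographically at most theta, comparing from the
    highest index down. Hence a feasible x that differs from theta above j has
    x_m < theta_m at the last such index m, which costs phi_j(m); the identity
    phi_j(m) = (u_j - theta_j) + sum over i in I, j < i < m, of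
    phi_j(i) (u_i - theta_i) says that this is just the most that the remaining
    terms can gain. The equality case supplies one tight point for each m in
    I_j; the point for m = n may moreover be changed freely at the coordinates
    outside I_j and different from j. Together with theta, truncated to the
    indices from j on, this makes n affinely independent points. *)

Set Implicit Arguments.
Unset Strict Implicit.
Unset Printing Implicit Defensive.

Import Order.TTheory GRing.Theory Num.Theory.

Local Open Scope classical_set_scope.
Local Open Scope ring_scope.

(** * Feasibility and the lexicographic order *)

Lemma big_ord_split (T : Type) (idx : T) (op : Monoid.com_law idx) (n : nat)
    (P : pred 'I_n) (m : 'I_n) (F : 'I_n -> T) :
  \big[op/idx]_(k < n | P k) F k =
  op (\big[op/idx]_(k < n | P k && (k < m)%N) F k)
     (op (if P m then F m else idx)
         (\big[op/idx]_(k < n | P k && (m < k)%N) F k)).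
Proof.
rewrite (bigID (fun k : 'I_n => (k < m)%N)) /=; congr (op _ _).
rewrite (bigID (pred1 m)) /=; congr (op _ _); last first.
  apply: eq_bigl => k.
  by rewrite -leqNgt -andbA [(m < k)%N]ltn_neqAle eq_sym [(m <= k)%N && _]andbC.
rewrite big_mkcond (bigD1 m) //= ltnn eqxx !andbT big1 ?Monoid.mulm1 // => k.
by move=> /negPf ->; rewrite andbF.
Qed.

Lemma superincreasing_sum_lt (n : nat) (a u : 'I_n -> nat) (m : 'I_n) :
  superincreasing a u -> (\sum_(k < n | (k < m)%N) a k * u k <= a m)%N.
Proof.
move=> hK; case: m => [[|m] ltm] /=; first by rewrite big_pred0.
exact: (hK (Ordinal (ltnW ltm)) (Ordinal ltm)).
Qed.

Lemma greedy_le_bound (n : nat) (a u : 'I_n -> nat) (b : nat)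
    (theta : 'I_n -> nat) (i : 'I_n) :
  is_greedy a u b theta -> (theta i <= u i)%N.
Proof. by move->; apply: geq_minl. Qed.

(** Once the coordinates above [m] agree with [theta], the greedy quotient is the largest value that
    the remaining capacity allows at [m]; the terms of [y] below [m] only use up more of it. *)
Lemma greedy_max (n : nat) (a u : 'I_n -> nat) (b : nat)
    (theta y : 'I_n -> nat) (m : 'I_n) :
    is_greedy a u b theta -> (0 < a m)%N ->
    (forall i, (y i <= u i)%N) -> (\sum_i a i * y i <= b)%N ->
    (forall i : 'I_n, (m < i)%N -> y i = theta i) ->
  (y m <= theta m)%N.
Proof.
move=> gr am yu yb ytheta; rewrite (gr m) leq_min yu leq_divRL // mulnC.
rewrite leq_subRL ?(is_greedy_feasible m.+1 gr) //.
apply: leq_trans yb.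
rewrite (big_ord_split _ xpredT m) /=.
rewrite [X in (_ <= _ + (_ + X))%N](eq_bigr (fun k => a k * theta k)%N); last first.
  by move=> k mk; rewrite ytheta.
by lia.
Qed.

(** By superincreasingness the whole box below [m] weighs at most [a m], so one unit given up at [m]
    pays for any choice there, and [y] weighs no more than [theta]. *)
Lemma lex_lt_greedy_feasible (n : nat) (a u : 'I_n -> nat) (b : nat)
    (theta y : 'I_n -> nat) (m : 'I_n) :
    superincreasing a u -> is_greedy a u b theta ->
    (forall i, (y i <= u i)%N) -> (y m < theta m)%N ->
    (forall i : 'I_n, (m < i)%N -> y i = theta i) ->
  (\sum_i a i * y i <= b)%N.
Proof.
move=> hK gr yu ym ytheta; apply: leq_trans (is_greedy_feasible 0 gr).
rewrite (big_ord_split _ xpredT m) (big_ord_split _ (fun=> true) m) /=.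
rewrite [X in (_ + (_ + X) <= _)%N](eq_bigr (fun k => a k * theta k)%N); last first.
  by move=> k mk; rewrite ytheta.
rewrite !addnA leq_add2r.
have le1: (\sum_(k < n | k < m) a k * y k <= a m)%N.
  apply: leq_trans (superincreasing_sum_lt m hK).
  by apply: leq_sum => k _; rewrite leq_mul.
have : (a m * (y m).+1 <= a m * theta m)%N by rewrite leq_mul.
rewrite mulnS => h; apply: leq_trans (leq_addl _ _).
by apply: leq_trans h; rewrite leq_add2r.
Qed.

(** * The coefficients and validity at integer points *)

(** Each summand is the increase of the product when the factor [w i + 1] is appended, so the sum
    telescopes from the empty product. *)
Lemma sum_prod_telescope (R : comPzRingType) (n : nat) (P : pred 'I_n)
    (w : 'I_n -> R) (m : nat) :
  (\sum_(i < n | P i && (i < m)%N)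
     (\prod_(k < n | P k && (k < i)%N) (w k + 1)) * w i) + 1 =
  \prod_(k < n | P k && (k < m)%N) (w k + 1).
Proof.
elim: m => [|m IH].
  by rewrite !big_pred0 ?add0r // => i; rewrite andbF.
(* The bound [m] is a plain natural number; from [n] on, raising it adds no index. *)
case: (ltnP m n) => [ltmn|lenm]; last first.
  have eqP1 : (fun k : 'I_n => P k && (k < m.+1)%N) =1 (fun k => P k && (k < m)%N).
    by move=> k; rewrite !(leq_trans (ltn_ord k)) // ltnW.
  by rewrite !(eq_bigl _ _ eqP1).
pose o := Ordinal ltmn.
have eqS (k : 'I_n) : (P k && (k < m.+1)%N) && (k != o) = P k && (k < m)%N.
  by rewrite -andbA ltnS ltn_neqAle -val_eqE /= [(_ <= _)%N && _]andbC.
have [Po|nPo] := boolP (P o); last first.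
  have eqP1 : (fun k : 'I_n => P k && (k < m.+1)%N) =1 (fun k => P k && (k < m)%N).
    move=> k; rewrite -eqS; case: eqVneq => [->|]; rewrite ?andbT //.
    by rewrite (negPf nPo).
  by rewrite !(eq_bigl _ _ eqP1).
rewrite (bigD1 o) ?Po //= [RHS](bigD1 o) ?Po //=.
rewrite !(eq_bigl _ _ eqS) -addrA IH; ring.
Qed.

Definition lifted_lhs (n : nat) (u theta y : 'I_n -> nat) (j : 'I_n) : int :=
  (y j)%:Z + \sum_(i < n | (1 <= theta i)%N && (j < i)%N)
               phi u theta j i * ((y i)%:Z - (theta i)%:Z).

Lemma phi_gt0 (n : nat) (u theta : 'I_n -> nat) (j i : 'I_n) :
    (forall k, (theta k <= u k)%N) -> (theta j < u j)%N ->
  0 < phi u theta j i.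
Proof.
move=> le_u hj; rewrite /phi mulr_gt0 ?subr_gt0 ?ltz_nat //.
by apply: prodr_gt0 => k _; have := le_u k; lia.
Qed.

Lemma phi_telescope (n : nat) (u theta : 'I_n -> nat) (j m : 'I_n) :
  phi u theta j m = (u j)%:Z - (theta j)%:Z +
    \sum_(i < n | ((1 <= theta i)%N && (j < i)%N) && (i < m)%N)
       phi u theta j i * ((u i)%:Z - (theta i)%:Z).
Proof.
have phiE i : phi u theta j i = ((u j)%:Z - (theta j)%:Z) *
    \prod_(k < n | ((1 <= theta k)%N && (j < k)%N) && (k < i)%N)
       (((u k)%:Z - (theta k)%:Z) + 1).
  rewrite /phi; congr (_ * _); apply: eq_big => k; first by rewrite andbA.
  by move=> _; ring.
rewrite {1}phiE -sum_prod_telescope mulrDr mulr1 addrC; congr (_ + _).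
by rewrite mulr_sumr; apply: eq_bigr => i _; rewrite phiE mulrA.
Qed.

(** Separates the loss at [m] from the possible gains below it; both validity and tightness start
    from this form. *)
Lemma lifted_lhs_last_diff (n : nat) (u theta y : 'I_n -> nat) (j m : 'I_n) :
    (1 <= theta m)%N -> (j < m)%N ->
    (forall i : 'I_n, (m < i)%N -> y i = theta i) ->
  lifted_lhs u theta y j = (y j)%:Z +
    \sum_(i < n | ((1 <= theta i)%N && (j < i)%N) && (i < m)%N)
       phi u theta j i * ((y i)%:Z - (theta i)%:Z)
    + phi u theta j m * ((y m)%:Z - (theta m)%:Z).
Proof.
move=> tm jm ytheta; rewrite /lifted_lhs (big_ord_split _ _ m) /= tm jm /=.
rewrite [X in _ + (_ + (_ + X))]big1 ?addr0 ?addrA // => i /andP[_ /ytheta ->].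
by rewrite subrr mulr0.
Qed.

Lemma lifted_lhs_le (n : nat) (a u : 'I_n -> nat) (b : nat)
    (theta y : 'I_n -> nat) (j : 'I_n) :
    is_greedy a u b theta -> (forall i, (0 < a i)%N) -> (theta j < u j)%N ->
    (forall i, (y i <= u i)%N) -> (\sum_i a i * y i <= b)%N ->
  lifted_lhs u theta y j <= (theta j)%:Z.
Proof.
move=> gr a_gt0 hj yu yb.
have le_u i := greedy_le_bound i gr.
(* If [y] differs from [theta] above [j], take [m] to be the largest such index; otherwise the sum
   vanishes and only [y j] remains. *)
case: (pickP [pred i : 'I_n | (j < i)%N && (y i != theta i)]) => [i0 Di0|no_diff].
  case: (arg_maxnP (fun i : 'I_n => val i) Di0) => /= m /andP[jm ym] m_max.
  have ytheta (i : 'I_n) : (m < i)%N -> y i = theta i.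
    move=> mi; apply/eqP/negPn/negP => yi.
    by have := m_max i; rewrite yi (ltn_trans jm mi) leqNgt mi => /(_ isT).
  have lt_m : (y m < theta m)%N.
    by rewrite ltn_neqAle ym (greedy_max gr).
  (* The strict drop at [m] also puts [m] in I, so its loss really appears in the sum. *)
  have tm : (1 <= theta m)%N by apply: leq_trans lt_m.
  rewrite (lifted_lhs_last_diff u tm jm ytheta).
  have : phi u theta j m * ((y m)%:Z - (theta m)%:Z) <= - phi u theta j m.
    rewrite -[leRHS]mulrN1 ler_pM2l ?phi_gt0 //; lia.
  have : \sum_(i < n | ((1 <= theta i)%N && (j < i)%N) && (i < m)%N)
       phi u theta j i * ((y i)%:Z - (theta i)%:Z) <=
     \sum_(i < n | ((1 <= theta i)%N && (j < i)%N) && (i < m)%N)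
       phi u theta j i * ((u i)%:Z - (theta i)%:Z).
    by apply: ler_sum => i _; rewrite ler_pM2l ?phi_gt0 // lerB ?lez_nat.
  have : (y j)%:Z <= (u j)%:Z by rewrite lez_nat.
  rewrite [in - phi u theta j m]phi_telescope; lra.
have ytheta (i : 'I_n) : (j < i)%N -> y i = theta i.
  by move=> ji; apply/eqP/negPn; have := no_diff i; rewrite /= ji => /= ->.
rewrite /lifted_lhs big1 ?addr0 ?lez_nat ?(greedy_max gr) // => i /andP[_ /ytheta ->].
by rewrite subrr mulr0.
Qed.

(** * Tight points and their affine independence *)

Lemma lifted_lhs_tight (n : nat) (u theta y : 'I_n -> nat) (j m : 'I_n) :
    (1 <= theta m)%N -> (j < m)%N ->
    (forall i : 'I_n, (m < i)%N -> y i = theta i) ->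
    y m = (theta m).-1 -> y j = u j ->
    (forall i : 'I_n, (1 <= theta i)%N -> (j < i < m)%N -> y i = u i) ->
  lifted_lhs u theta y j = (theta j)%:Z.
Proof.
move=> tm jm ytheta ym yj yu; rewrite (lifted_lhs_last_diff u tm jm ytheta).
have -> : (y m)%:Z - (theta m)%:Z = -1 by rewrite ym; lia.
rewrite mulrN1 [in - _]phi_telescope yj.
rewrite (eq_bigr (fun i => phi u theta j i * ((u i)%:Z - (theta i)%:Z))).
  ring.
by move=> i /andP[/andP[ti ji] im]; rewrite yu // ji im.
Qed.

(* The tight points other than theta: theta above m, lowered by one at m, and
   the bounds u at j and at the elements of I between j and m; by phi_telescope
   the gain below m exactly cancels the loss phi_j(m) at m. *)
Definition block_point (n : nat) (u theta : 'I_n -> nat) (j m i : 'I_n) : nat :=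
  if (m < i)%N then theta i
  else if i == m then (theta i).-1
  else if (i == j) || ((1 <= theta i)%N && (j < i)%N) then u i
  else 0%N.

(* Zeroing the coordinates below j, and those above j outside I, makes the unit
   perturbations in the last branch the only points that move them, so they drop
   out first in the independence proof. *)
Definition facet_point (n : nat) (u theta : 'I_n -> nat) (j top k i : 'I_n) : nat :=
  if k == j then if (j <= i)%N then theta i else 0%N
  else if (1 <= theta k)%N && (j < k)%N then block_point u theta j k i
  else if i == k then 1%N
  else block_point u theta j top i.

Section FacetPoints.

Variables (n : nat) (a u : 'I_n -> nat) (b : nat) (theta : 'I_n -> nat).
Variables (j top : 'I_n).
Hypothesis u_gt0 : forall i, (0 < u i)%N.
Hypothesis hK : superincreasing a u.
Hypothesis gr : is_greedy a u b theta.
Hypothesis hj : (theta j < u j)%N.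
Hypothesis top_max : forall i : 'I_n, (i <= top)%N.
Hypothesis theta_top : theta top = u top.

Local Notation pt := (facet_point u theta j top).

Lemma lt_top_of_slack : (j < top)%N.
Proof.
rewrite ltn_neqAle top_max andbT; apply/eqP => /val_inj e.
by move: hj; rewrite e theta_top ltnn.
Qed.

Let theta_top_gt0 : (1 <= theta top)%N. Proof. by rewrite theta_top. Qed.

Lemma facet_point_le k i : (pt k i <= u i)%N.
Proof.
have := greedy_le_bound i gr; have := u_gt0 i.
rewrite /facet_point /block_point; do ![case: ifP => _]; lia.
Qed.

(** One pattern covers all points but [theta]: take [m = k] for [k] in I_j and [m = top] otherwise.
    In the latter case the entry 1 at [k] sits where the pattern prescribes nothing. *)
Lemma facet_point_block k :
  k != j -> exists m : 'I_n,
    [/\ (1 <= theta m)%N && (j < m)%N,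
        forall i : 'I_n, (m < i)%N -> pt k i = theta i,
        pt k m = (theta m).-1, pt k j = u j &
        forall i : 'I_n, (1 <= theta i)%N -> (j < i < m)%N -> pt k i = u i].
Proof.
have lt_jtop := lt_top_of_slack.
move=> kj; have [/andP[tk jk]|nPk] := boolP ((1 <= theta k)%N && (j < k)%N).
  exists k; rewrite tk jk; split=> // [i ki|||i ti /andP[ji ik]];
    rewrite /facet_point (negPf kj) tk jk /= /block_point.
  - by rewrite ki.
  - by rewrite ltnn eqxx.
  - by rewrite ltnNge (ltnW jk) -val_eqE /= ltn_eqF // eqxx.
  - by rewrite ltnNge (ltnW ik) /= -val_eqE /= ltn_eqF // ti ji orbT.
exists top; split=> [|i|||i ti /andP[ji itop]].
- by rewrite theta_top_gt0.
- by rewrite ltnNge top_max.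
- rewrite /facet_point (negPf kj) (negPf nPk) /block_point ltnn eqxx.
  by case: eqVneq nPk => // <-; rewrite theta_top_gt0 lt_top_of_slack.
- rewrite /facet_point (negPf kj) (negPf nPk) eq_sym (negPf kj) /block_point.
  by rewrite ltnNge (ltnW lt_jtop) -val_eqE /= ltn_eqF // eqxx.
- rewrite /facet_point (negPf kj) (negPf nPk) /block_point.
  case: eqVneq nPk => [<-|_ _]; first by rewrite ti ji.
  by rewrite ltnNge (ltnW itop) /= -val_eqE /= ltn_eqF // ti ji orbT.
Qed.

Lemma facet_point_feasible k : (\sum_i a i * pt k i <= b)%N.
Proof.
have [->|kj] := eqVneq k j.
  apply: leq_trans (is_greedy_feasible 0 gr); apply: leq_sum => i _.
  by rewrite leq_mul // /facet_point eqxx; case: ifP.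
have [m [/andP[tm jm] ptheta pm _ _]] := facet_point_block kj.
apply: (lex_lt_greedy_feasible hK gr (facet_point_le k) _ ptheta).
by rewrite pm prednK.
Qed.

Lemma facet_point_tight k : lifted_lhs u theta (pt k) j = (theta j)%:Z.
Proof.
have [->|kj] := eqVneq k j.
  rewrite /lifted_lhs /facet_point eqxx leqnn big1 ?addr0 // => i /andP[_ ji].
  by rewrite (ltnW ji) subrr mulr0.
have [m [/andP[tm jm] ptheta pm pj pu]] := facet_point_block kj.
exact: (lifted_lhs_tight tm jm ptheta pm pj pu).
Qed.

Lemma facet_point_free k k' :
  k != j -> ~~ ((1 <= theta k)%N && (j < k)%N) -> pt k' k = (k' == k).
Proof.
move=> kj nPk.
(* If [k] is not below [j], it lies above [j] but outside I, so [theta] vanishes there. *)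
have th0 (i : 'I_n) : (j <= i)%N -> (i <= k)%N -> theta k = 0%N.
  move=> ji ik; have jk : (j < k)%N.
    by rewrite ltn_neqAle (leq_trans ji ik) andbT val_eqE eq_sym.
  by move: nPk; rewrite jk andbT -eqn0Ngt => /eqP.
rewrite /facet_point /block_point (negPf kj) (negPf nPk) /=.
case: (eqVneq k' j) => [->|k'j].
  by rewrite eq_sym (negPf kj); case: ifP => // /th0; apply.
case: ifP => [/andP[tk' jk']|_]; rewrite [k == k']eq_sym.
  case: ifP => [k'k|_].
    by rewrite (th0 k' (ltnW jk') (ltnW k'k)) -val_eqE /= ltn_eqF.
  by case: eqVneq nPk => // <-; rewrite tk' jk'.
case: eqVneq => // _; rewrite ltnNge top_max /=.
by case: eqVneq nPk => // ->; rewrite theta_top_gt0 lt_top_of_slack.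
Qed.

(** Triangular elimination: the free coordinates isolate their own coefficients, then I_j is cleared
    from the highest index down, and the zero coefficient sum settles [j]. *)
Lemma facet_points_independent (R : realType) :
  affinely_independent (fun k : 'I_n => \row_i (pt k i)%:R : 'rV[R]_n).
Proof.
move=> c c0 cp0.
have cpi (i : 'I_n) : \sum_k c k * (pt k i)%:R = 0.
  have /rowP/(_ i) := cp0; rewrite summxE mxE => cp0i; rewrite -[RHS]cp0i.
  by apply: eq_bigr => k _; rewrite !mxE.
have c_free k : k != j -> ~~ ((1 <= theta k)%N && (j < k)%N) -> c k = 0.
  move=> kj nPk; have := cpi k; rewrite (bigD1 k) //= big1 ?addr0 => [|k' k'k].
    by rewrite facet_point_free // eqxx mulr1.
  by rewrite facet_point_free // (negPf k'k) mulr0.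
have c_j k : k != j -> c k = 0.
  (* At coordinate k in I_j, the point k contributes -1 relative to theta k, and
     among the others only those with larger index in I_j contribute. *)
  have [d] := ubnP (n - k)%N; elim: d k => // d IHd k ltd kj.
  have [/andP[tk jk]|] := boolP ((1 <= theta k)%N && (j < k)%N); last exact: c_free.
  (* Subtracting the constant [theta k] is harmless because the coefficients sum to zero. *)
  have : \sum_k' c k' * ((pt k' k)%:R - (theta k)%:R) = 0.
    under eq_bigr => k' _ do rewrite mulrBr.
    by rewrite sumrB -mulr_suml c0 mul0r cpi subrr.
  rewrite (bigD1 k) //= big1 ?addr0 => [|k' k'k].
    rewrite /facet_point /block_point (negPf kj) tk jk ltnn eqxx /=.
    have -> : (theta k)%:R = (theta k).-1%:R + 1 :> R by rewrite natr1 prednK.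
    by rewrite opprD addNKr mulrN1 => /eqP; rewrite oppr_eq0 => /eqP.
  have [->|k'j] := eqVneq k' j.
    by rewrite /facet_point eqxx (ltnW jk) subrr mulr0.
  have [/andP[tk' jk']|nP] := boolP ((1 <= theta k')%N && (j < k')%N); last first.
    by rewrite c_free ?mul0r.
  have [ltkk'|] := ltnP k k'.
    by rewrite IHd ?mul0r // (leq_trans _ (ltd : (n - k <= d)%N)) // ltn_sub2l.
  rewrite leq_eqVlt val_eqE (negPf k'k) /= => k'k'.
  by rewrite /facet_point /block_point (negPf k'j) tk' jk' k'k' subrr mulr0.
move=> k; have [->|] := eqVneq k j; last exact: c_j.
by move: c0; rewrite (bigD1 j) //= big1 ?addr0.
Qed.

End FacetPoints.

(** * Passage to the convex hull *)

Lemma conv_hull_sub_halfspace (R : realType) (n : nat) (A : set 'rV[R]_n)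
    (f : 'rV[R]_n -> R) (d : R) :
    (forall x y t, f (t *: x + (1 - t) *: y) = t * f x + (1 - t) * f y) ->
    (forall x, A x -> f x <= d) ->
  forall x, conv_hull A x -> f x <= d.
Proof.
move=> f_affine fA; apply: smallest_sub => // x y t.
rewrite !inE /= => fx fy; rewrite f_affine.
have t0 : 0 <= t%:num by [].
have t1 : 0 <= 1 - t%:num by rewrite subr_ge0.
have -> : d = t%:num * d + (1 - t%:num) * d by ring.
by rewrite lerD // ler_wpM2l.
Qed.

Theorem proposition7 (R : realType) (n : nat) (a u : 'I_n -> nat) (b : nat)
    (theta : 'I_n -> nat) (j : 'I_n)
    (hn : (1 <= n)%N)
    (hb : (0 < b)%N)
    (ha : forall i, (0 < a i)%N)
    (hu : forall i, (0 < u i)%N)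
    (hau : forall i, (a i * u i <= b)%N)
    (hb_lt : (b < \sum_i a i * u i)%N)
    (hK : superincreasing a u)
    (htheta : is_greedy a u b theta)
    (hj : (theta j < u j)%N) :
  facet_defining
    (conv_hull [set map_mx (fun z : int => z%:~R : R) x | x in knapsack a u b])
    (fun x : 'rV[R]_n =>
       x 0 j + \sum_(i < n | (1 <= theta i)%N && (j < i)%N)
                 (phi u theta j i)%:~R * (x 0 i - (theta i)%:R))
    (theta j)%:R.
Proof.
pose f := fun x : 'rV[R]_n =>
  x 0 j + \sum_(i < n | (1 <= theta i)%N && (j < i)%N)
            (phi u theta j i)%:~R * (x 0 i - (theta i)%:R).
rewrite -/f.
have ltn1 : (n.-1 < n)%N by rewrite prednK.
pose top := Ordinal ltn1.
have top_max (i : 'I_n) : (i <= top)%N by rewrite /= -ltnS prednK.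
(* Nothing is packed before [top], and [hau] lets it be filled to its bound. *)
have theta_top : theta top = u top.
  rewrite htheta big_pred0 => [|k]; last by rewrite ltnNge top_max.
  by apply/minn_idPl; rewrite subn0 leq_divRL // mulnC.
have fE (y : 'I_n -> nat) : f (\row_i (y i)%:R) = (lifted_lhs u theta y j)%:~R.
  rewrite /f /lifted_lhs mxE rmorphD rmorph_sum /=; congr (_ + _).
  by apply: eq_bigr => i _; rewrite mxE intrM intrB -!pmulrn.
have in_hull (y : 'I_n -> nat) :
    (forall i, (y i <= u i)%N) -> (\sum_i a i * y i <= b)%N ->
  conv_hull [set map_mx (fun z : int => z%:~R : R) x | x in knapsack a u b]
    (\row_i (y i)%:R).
  move=> yu yb; apply: sub_gen_smallest; exists (\row_i (y i)%:Z).
    split=> [|i]; last by rewrite mxE lez_nat yu.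
    move: yb; rewrite -lez_nat; apply: le_trans.
    by rewrite -natz natr_sum; apply: ler_sum => i _; rewrite mxE natrM !natz.
  by apply/rowP => i; rewrite !mxE.
split.
- apply: conv_hull_sub_halfspace => [x y t|_ [x [xb xu] <-]].
    rewrite /f !mxE !mulrDr !mulr_sumr [RHS]addrACA -big_split /=; congr (_ + _).
    by apply: eq_bigr => i _; rewrite !mxE; ring.
  pose y i := absz (x 0 i).
  have xE i : x 0 i = (y i)%:Z by rewrite /y gez0_abs //; case/andP: (xu i).
  have -> : map_mx (fun z : int => z%:~R : R) x = \row_i (y i)%:R.
    by apply/rowP => i; rewrite !mxE xE.
  rewrite fE -[leRHS]/((theta j)%:Z%:~R) ler_int.
  apply: (lifted_lhs_le htheta) => // [i|].
    by rewrite -lez_nat -xE; case/andP: (xu i).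
  rewrite -lez_nat; apply: le_trans xb.
  by rewrite -natz natr_sum; apply: ler_sum => i _; rewrite xE natrM !natz.
- exists (fun k => \row_i (facet_point u theta j top k i)%:R).
    exact: facet_points_independent.
  move=> k; split.
    apply: in_hull; first by move=> i; apply: facet_point_le.
    exact: facet_point_feasible.
  by rewrite fE facet_point_tight.
(* The origin is feasible but not tight: [top] lies in I_j and contributes a negative term, while no
   other term is positive. *)
- move=> /seteqP[_ /(_ (\row_i (0%N)%:R))].
  case => [|_].
    by apply: (in_hull (fun=> 0%N)) => //; rewrite big1 // => i _; rewrite muln0.
  rewrite fE -[RHS]/((theta j)%:Z%:~R) => /intr_inj; apply/eqP.
  rewrite lt_eqF // (lt_le_trans _ (le0z_nat (theta j))) //.
  have le_u i := greedy_le_bound i htheta.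
  have jtop := lt_top_of_slack hj top_max theta_top.
  rewrite /lifted_lhs add0r (bigD1 top) /= ?theta_top ?hu //.
  apply: ltr_wnDr.
    apply: sumr_le0 => i _; rewrite sub0r mulrN oppr_le0.
    by rewrite mulr_ge0 // ltW // phi_gt0.
  by rewrite sub0r mulrN oppr_lt0 mulr_gt0 ?phi_gt0 // ltz_nat.
Qed.
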